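(* Let $G$ be a graph, let $I_c(G)$ be the ideal of covers of $G$, and let $\omega(G)$ be the clique number of $G$. Then the resurgence and ic-resurgence of $I_c(G)$ satisfy $$\rho(I_c(G))\geq\rho_{ic}(I_c(G))\geq\frac{2(\omega(G)-1)}{\omega(G)}$$ with equality everywhere if $G$ is perfect.
   Context: Graphs are finite and simple with non-empty vertex set; $V(G)=\{t_1,\ldots,t_s\}$ and $S=K[t_1,\ldots,t_s]$ is the polynomial ring over a field $K$. A vertex cover of $G$ is a set of vertices meeting every edge; it is minimal if it is minimal with respect to inclusion. The ideal of covers $I_c(G)$ is the ideal of $S$ generated by all squarefree monomials $\prod_{t_i\in D}t_i$ with $D$ a minimal vertex cover of $G$. The clique number $\omega(G)$ is the largest number of vertices of a complete subgraph of $G$. $G$ is perfect if $\omega(H)=\chi(H)$ for every induced subgraph $H$ of $G$, where $\chi$ is the chromatic number. For an ideal $I$ of $S$ with minimal primes $\mathfrak{p}_1,\ldots,\mathfrak{p}_r$ and $n\geq 1$, the $n$-th symbolic power is $I^{(n)}=\bigcap_{i=1}^r(I^nS_{\mathfrak{p}_i}\cap S)$. $\overline{L}$ denotes the integral closure of an ideal $L$. For a squarefree monomial ideal $I$, the resurgence is $\rho(I)=\sup\{m/r\mid I^{(m)}\not\subset I^r\}$ and the ic-resurgence is $\rho_{ic}(I)=\sup\{m/r\mid I^{(m)}\not\subset\overline{I^r}\}$, where $m,r$ range over positive integers and suprema are taken in $[0,\infty]$. *)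

(* Defs.v *)
From HB Require Import structures.
From mathcomp Require Import all_boot all_order all_algebra.
(* mpoly has to be loaded before the analysis files *)
From mathcomp Require Import mpoly.
From mathcomp Require Import classical_sets reals constructive_ereal ereal.

Set Implicit Arguments.
Unset Strict Implicit.
Unset Printing Implicit Defensive.

Import Order.TTheory GRing.Theory Num.Theory.

(* [symmetric] alone is the notion of symmetric polynomial from mpoly *)
Record sgraph (T : finType) := SGraph {
  edge :> rel T;
  edge_sym : ssrbool.symmetric edge;
  edge_irr : irreflexive edge }.

Section Graphs.
Variables (T : finType) (G : sgraph T).

Definition clique (A : {set T}) : bool :=
  [forall x in A, forall y in A, (x != y) ==> G x y].

Definition clique_number : nat := \max_(A : {set T} | clique A) #|A|.

Definition colorable (k : nat) : bool :=
  [exists f : {ffun T -> 'I_k}, forall x, forall y, G x y ==> (f x != f y)].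

Lemma colorable_ex : exists k, colorable k.
Proof.
exists #|T|; apply/existsP; exists [ffun x => enum_rank x].
apply/forallP=> x; apply/forallP=> y; apply/implyP=> xy.
rewrite !ffunE (inj_eq enum_rank_inj).
by apply: contraTneq xy => ->; rewrite edge_irr.
Qed.

Definition chromatic_number : nat := ex_minn colorable_ex.

Definition vertex_cover (D : {set T}) : bool :=
  [forall x, forall y, G x y ==> (x \in D) || (y \in D)].

Definition minimal_vertex_cover (D : {set T}) : bool := minset vertex_cover D.

Definition induced_rel (A : {set T}) : rel {x : T | x \in A} :=
  fun x y => G (val x) (val y).

Lemma induced_sym A : ssrbool.symmetric (@induced_rel A).
Proof. by move=> x y; apply: edge_sym. Qed.

Lemma induced_irr A : irreflexive (@induced_rel A).
Proof. by move=> x; apply: edge_irr. Qed.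

Definition induced (A : {set T}) : sgraph {x : T | x \in A} :=
  SGraph (@induced_sym A) (@induced_irr A).

End Graphs.

Definition perfect (T : finType) (G : sgraph T) : Prop :=
  forall A : {set T}, A != finset.set0 ->
    clique_number (induced G A) = chromatic_number (induced G A).

Local Open Scope classical_set_scope.
Local Open Scope ring_scope.

Section Ideals.
Variable R : comNzRingType.
Implicit Types (I J P A C : set R).

(* finite sums of products c * g with c in C and g in A *)
Definition span C A : set R :=
  [set x | exists k (c g : 'I_k -> R),
     (forall i, C (c i) /\ A (g i)) /\ x = \sum_(i < k) c i * g i].

Definition ideal_gen A : set R := span setT A.

Definition is_ideal I : Prop :=
  [/\ I 0, forall x y, I x -> I y -> I (x + y) & forall a x, I x -> I (a * x)].

Definition is_prime_ideal P : Prop :=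
  [/\ is_ideal P, ~ P 1 & forall x y, P (x * y) -> P x \/ P y].

Definition minimal_prime I P : Prop :=
  [/\ is_prime_ideal P, I `<=` P &
      forall Q, is_prime_ideal Q -> I `<=` Q -> Q `<=` P -> Q = P].

Definition ideal_mul I J : set R :=
  ideal_gen [set x * y | x in I & y in J].

Definition ideal_exp I (n : nat) : set R := iter n (ideal_mul I) setT.

Definition integral_closure I : set R :=
  [set x | exists k (a : 'I_k -> R),
     [/\ (0 < k)%N, forall i : 'I_k, ideal_exp I i.+1 (a i) &
         x ^+ k + \sum_(i < k) a i * x ^+ (k - i.+1) = 0]].

End Ideals.

Section SymbolicPowers.
Variable R : idomainType.
Implicit Types (I J P : set R).

(* R_P, realised inside the fraction field of the domain R *)
Definition local_ring P : set {fraction R} :=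
  [set z | exists a b, ~ P b /\ z = tofrac a / tofrac b].

(* J R_P \cap R *)
Definition local_contraction P J : set R :=
  @tofrac R @^-1` span (local_ring P) (@tofrac R @` J).

Definition symbolic_power I (n : nat) : set R :=
  \bigcap_(P in minimal_prime I) local_contraction P (ideal_exp I n).

End SymbolicPowers.

Section Resurgence.
Variables (F : realType) (R : idomainType).
Implicit Types I : set R.

(* The element 0 is added because suprema are taken in [0, +oo], whereas
   [ereal_sup set0] is -oo. *)
Definition resurgence I : \bar F :=
  ereal_sup (0%E |` [set q | exists m r : nat,
    [/\ (0 < m)%N, (0 < r)%N, ~ (symbolic_power I m `<=` ideal_exp I r) &
        q = (m%:R / r%:R)%:E]]).

Definition ic_resurgence I : \bar F :=
  ereal_sup (0%E |` [set q | exists m r : nat,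
    [/\ (0 < m)%N, (0 < r)%N,
        ~ (symbolic_power I m `<=` integral_closure (ideal_exp I r)) &
        q = (m%:R / r%:R)%:E]]).

End Resurgence.

Definition cover_ideal (K : fieldType) (s : nat) (G : sgraph 'I_s) :
    set {mpoly K[s]} :=
  ideal_gen [set p | exists D : {set 'I_s},
    minimal_vertex_cover G D /\ p = \prod_(i in D) 'X_i].

Arguments cover_ideal K {s} G.

(* Main.v *)
Require Import Defs.
From HB Require Import structures.
From mathcomp Require Import all_boot all_order all_algebra.
From mathcomp Require Import mpoly.
From mathcomp Require Import boolp classical_sets reals constructive_ereal ereal.
From mathcomp Require Import zify ring lra.

(** Write I for the ideal of covers, w for the clique number, and a(C) for the
    sum of the exponents of a monomial x^a over a set C of variables.

    A set of vertices meets every vertex cover only if it contains an edge, so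
    the minimal primes of I are the ideals (x_i, x_j) with ij an edge
    ([minimal_prime_coverP]).  Localizing at (x_i, x_j) turns I into (x_i, x_j),
    because the complement of a vertex is a cover.  Hence I^(n) is the monomial
    ideal of the x^a with a_i + a_j >= n on every edge
    ([symbolic_power_coverP]).

    Lower bound.  A cover misses at most one vertex of a clique C, so every
    monomial of I^r, and every monomial integral over I^r, satisfies
    a(C) >= r (|C| - 1).  If C is a clique with w >= 2 vertices, the (w-1)t-th
    power of the product of all variables lies in I^(2(w-1)t) and has
    a(C) = w(w-1)t < (wt+1)(w-1), so it is not integral over I^(wt+1)
    ([symbolic_power_cover_nsub]).  The ratios 2(w-1)t / (wt+1) tend to
    2(w-1)/w.  For w = 1 the bound is zero.

    Upper bound for a perfect graph.  By complementation, x^a lies in I^r as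
    soon as there are r stable sets such that each vertex i is in at least
    r - a_i of them: a colouring of the graph weighted by max(r - a_i, 0).
    Lovasz's theorem on replication of vertices ([perfect_weighted_colorable])
    says that such a colouring exists once every clique has weight at most r.
    If x^a is in I^(n), adding the inequalities a_i + a_j >= n over a clique C
    with at least two vertices gives 2 a(C) >= |C| n, and this makes all
    cliques light enough when n / r >= 2(w-1)/w ([symbolic_power_cover_sub]).
    Therefore I^(n) is contained in I^r beyond the bound, which squeezes both
    resurgences, as I^r is contained in its integral closure. *)

Set Implicit Arguments.
Unset Strict Implicit.
Unset Printing Implicit Defensive.
Import Order.TTheory GRing.Theory Num.Theory.

(** * Weighted colourings of perfect graphs *)

Lemma cliqueP (T : finType) (G : sgraph T) (C : {set T}) :
  reflect {in C &, forall x y, x != y -> G x y} (clique G C).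
Proof.
apply: (iffP forall_inP) => [H x y xC yC|H x xC].
  by move/forall_inP/(_ y yC)/implyP: (H x xC).
by apply/forall_inP => y yC; apply/implyP; apply: H.
Qed.

Section WeightedColouring.
Variables (T : finType) (G : sgraph T).
Implicit Types (A C S : {set T}) (b : T -> nat).

Definition stable S : bool := [forall x in S, forall y in S, ~~ G x y].

Lemma stableP S : reflect {in S &, forall x y, ~~ G x y} (stable S).
Proof.
apply: (iffP forall_inP) => [H x y xC yC|H x xC].
  by move/forall_inP/(_ y yC): (H x xC).
by apply/forall_inP => y yC; apply: H.
Qed.

Lemma sub_clique A C : A \subset C -> clique G C -> clique G A.
Proof.
move=> /fintype.subsetP AC /cliqueP cC; apply/cliqueP => x y /AC xC /AC.
exact: cC.
Qed.

Lemma clique_set1 v : clique G [set v]%SET.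
Proof. by apply/cliqueP => x y /set1P-> /set1P->; rewrite eqxx. Qed.

Lemma stable_set0 : stable finset.set0.
Proof. by apply/stableP => x y; rewrite finset.in_set0. Qed.

Lemma card_cliqueI_stable C S : clique G C -> stable S -> (#|C :&: S| <= 1)%N.
Proof.
move=> /cliqueP cC /stableP sS; rewrite leqNgt; apply/card_gt1P.
move=> [x [y [/setIP[xC xS] /setIP[yC yS] xy]]].
by have := cC _ _ xC yC xy; apply/negP/sS.
Qed.

(** The stable sets may repeat and may cover a vertex more often than [b] asks.
    This leaves room to add or enlarge classes in the induction, and it matches
    the fact that I^r is closed under multiplication by monomials. *)
Definition weighted_colorable b k : Prop := exists s : seq {set T},
  [/\ size s = k, all stable s & forall v, (b v <= count (fun S => v \in S) s)%N].

Lemma clique_weight_le C b s : clique G C -> all stable s ->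
  (forall v, (b v <= count (fun S => v \in S) s)%N) ->
  (\sum_(v in C) b v <= \sum_(S <- s) #|C :&: S|)%N.
Proof.
move=> cC ss bs; apply: (@leq_trans (\sum_(v in C) count (fun S => v \in S) s)).
  by apply: leq_sum.
rewrite (eq_bigr (fun v => \sum_(S <- s) (v \in S))%N) => [|v _]; last first.
  by rewrite -sum1_count big_mkcond.
rewrite exchange_big /=; apply: leq_sum => S _.
rewrite -sum1_card [leqRHS](eq_bigl (fun v => (v \in C) && (v \in S))) => [|v].
  by rewrite -big_mkcondr.
by rewrite inE.
Qed.

Lemma weighted_colorable_le b k l : (k <= l)%N ->
  weighted_colorable b k -> weighted_colorable b l.
Proof.
move=> kl [s [sk ss bs]]; exists (s ++ nseq (l - k) finset.set0).
split.
- by rewrite size_cat size_nseq sk subnKC.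
- by rewrite all_cat ss all_nseq stable_set0 orbT.
- by move=> v; rewrite count_cat (leq_trans (bs v)) ?leq_addr.
Qed.

(** For weights 0 and 1, a weighted colouring is a colouring of the subgraph
    induced by the support: the definition of perfection applies directly. *)
Lemma indicator_colorable A k : perfect G ->
    (forall C, clique G C -> (#|C :&: A| <= k)%N) ->
  weighted_colorable (fun v => nat_of_bool (v \in A)) k.
Proof.
move=> perfG; have [->|A0] := eqVneq A finset.set0.
  move=> _; apply: (@weighted_colorable_le _ 0%N) => //.
  by exists [::]; split=> // v; rewrite finset.in_set0.
move=> clA; have := perfG A A0.
rewrite /chromatic_number; case: ex_minnP => n /existsP[f /forallP fcol] _ cln.
apply: (@weighted_colorable_le _ n).
  rewrite -cln; apply/bigmax_leqP => C /cliqueP cC.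
  rewrite -(card_imset _ val_inj); set D := [set val x | x in C]%SET.
  have DA : D \subset A by apply/fintype.subsetP => _ /imsetP[x _ ->]; apply: valP.
  rewrite -(finset.setIidPl DA); apply: clA; apply/cliqueP.
  move=> _ _ /imsetP[x xC ->] /imsetP[y yC ->] xy; apply: (cC x y) => //.
exists [seq [set val x | x in [set x | f x == i]]%SET | i : 'I_n]; split.
- by rewrite size_map -cardT card_ord.
- apply/allP => _ /mapP[i _ ->]; apply/stableP.
  move=> _ _ /imsetP[x + ->] /imsetP[y + ->]; rewrite !inE => /eqP fx /eqP fy.
  apply/negP => xy; have /forallP/(_ y)/implyP/(_ xy) := fcol x.
  by rewrite fx fy eqxx.
- move=> v; case: (boolP (v \in A)) => // vA; rewrite -has_count; apply/hasP.
  exists [set val x | x in [set x | f x == f (exist _ v vA)]]%SET.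
    by apply/mapP; exists (f (exist _ v vA)); rewrite ?mem_enum.
  by apply/imsetP; exists (exist _ v vA); rewrite ?inE.
Qed.

(** Lovasz's replication argument, by induction on the total weight.  Weights at
    most 1 are the case of induced subgraphs.  Otherwise some [v] has weight at
    least 2; lower it by one to get [b'], colour [b'] with [k] stable sets, and
    let [A] be one of them that contains [v].  Each clique of [b']-weight [k]
    meets every one of the [k] stable sets, in particular [A], and it avoids
    [v], since otherwise its [b]-weight would be [k.+1].  So removing one copy of
    [A :\ v] from [b'] lowers the weight of all those cliques: the rest can be
    coloured with [k.-1] sets, and putting [A] back gives one more copy of every
    vertex of [A], including the missing copy of [v]. *)
Theorem perfect_weighted_colorable b k : perfect G ->
    (forall C, clique G C -> (\sum_(v in C) b v <= k)%N) ->
  weighted_colorable b k.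
Proof.
move=> perfG; have [n] := ubnP (\sum_v b v).
elim: n b k => // n IHn b k; rewrite ltnS => bn clb.
have [/existsP[v bv]|] := boolP [exists v, 1 < b v]%N; last first.
  rewrite negb_exists => /forallP b1.
  have bE v : b v = (v \in [set v | 0 < b v]%SET).
    by have := b1 v; rewrite inE -leqNgt; case: (b v) => [|[]].
  have [|s [sk ss bs]] := @indicator_colorable [set v | 0 < b v]%SET k perfG.
    move=> C /clb; apply: leq_trans; rewrite -sum1_card.
    rewrite (eq_bigl (fun v => (v \in C) && (v \in [set v | 0 < b v]%SET))).
      rewrite big_mkcondr; apply: leq_sum => v _.
      by rewrite [leqRHS]bE; case: (v \in _).
    by move=> v; rewrite finset.in_setI.
  by exists s; split=> // v; rewrite bE.
pose b' u := (b u - (u == v))%N.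
have b'b u : (b' u <= b u)%N by apply: leq_subr.
have sum_dec : (\sum_u b' u < \sum_u b u)%N.
  rewrite (bigD1 v) //= [ltnRHS](bigD1 v) //= -addSn leq_add ?leq_sum //.
  by rewrite /b' eqxx subn1 prednK // ltnW.
have [|C cC|s [sk ss bs]] := IHn b' k.
- exact: leq_trans sum_dec bn.
- by apply: leq_trans (clb C cC); apply: leq_sum.
have /hasP[A As vA] : has (fun S => v \in S) s.
  by rewrite has_count (leq_trans _ (bs v)) // /b' eqxx subn_gt0.
have stA : stable A by apply: (allP ss).
(* subtraction truncates: A may contain vertices whose b'-weight is 0 *)
pose b'' u := (b' u - ((u \in A) && (u != v)))%N.
have k0 : (0 < k)%N by rewrite -sk; case: (s) As.
have [| |t [tk ts bt]] := IHn b'' k.-1.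
- apply: leq_trans bn; apply: leq_ltn_trans sum_dec.
  by apply: leq_sum => u _; apply: leq_subr.
- move=> C cC; rewrite -ltnS prednK //.
  (* On the support of b' the subtraction in b'' is genuine, so the clique
     has to be cut down to that support. *)
  pose D := C :&: [set u | 0 < b' u]%SET.
  have cD : clique G D by apply: sub_clique cC; apply: finset.subsetIl.
  have b0 (c : T -> nat) : (forall u, c u <= b' u)%N ->
      (\sum_(u in C) c u = \sum_(u in D) c u)%N.
    move=> cb; rewrite [RHS](eq_bigl (fun v => (v \in C) && (v \in [set u | 0 < b' u]%SET))).
      rewrite [RHS]big_mkcondr; apply: eq_bigr => u _; rewrite inE.
      by have := cb u; case: (b' u) => //; rewrite leqn0 => /eqP.
    by move=> u; rewrite finset.in_setI.
  rewrite b0; last by move=> u; apply: leq_subr.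
  rewrite ltnNge; apply/negP => kD.
  have kD' : (k <= \sum_(u in D) b' u)%N.
    by apply: leq_trans kD _; apply: leq_sum => u _; apply: leq_subr.
  have := leq_trans kD' (clique_weight_le cD ss bs).
  have [DA0|[u]] := finset.set_0Vmem (D :&: A).
    (* A misses D, so the k - 1 other sets would have to cover weight k *)
    rewrite (perm_big _ (perm_to_rem As)) /= big_cons DA0 cards0 add0n.
    move=> kle; suff : (k <= k.-1)%N by rewrite -ltnS prednK // ltnn.
    apply: leq_trans kle _; rewrite -sk -(size_rem As) -sum1_size.
    rewrite !big_seq; apply: leq_sum => S /mem_rem /(allP ss).
    exact: card_cliqueI_stable.
  move=> /setIP[uD uA] _.
  have [uv|uv] := eqVneq u v.
    (* D contains v, hence is heavier for b than for b' *)
    have := clb _ cD; rewrite leqNgt => /negP; apply; apply: leq_ltn_trans kD' _.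
    rewrite -uv in vA; rewrite (bigD1 u) //= [ltnRHS](bigD1 u) //= -addSn leq_add //.
      by rewrite /b' uv eqxx subn1 prednK // ltnW.
    by apply: leq_sum.
  have := clb _ cD; rewrite leqNgt => /negP; apply; apply: leq_ltn_trans kD _.
  rewrite (bigD1 u) //= [ltnRHS](bigD1 u) //= -addSn leq_add //; last first.
    by apply: leq_sum => w _; apply: leq_trans (leq_subr _ _) (b'b w).
  rewrite /b'' uA uv subn1 prednK //.
  by move: uD; rewrite 2!inE => /andP[].
exists (A :: t); split=> /=; [by rewrite tk prednK|by rewrite stA|move=> u].
have := bt u; rewrite /b'' /b'; have [->|_] := eqVneq u v.
  by rewrite vA andbF subn0 add1n leq_subLR add1n.
by rewrite subn0 andbT leq_subLR.
Qed.

End WeightedColouring.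

Local Open Scope classical_set_scope.
Local Open Scope ring_scope.

(** * Powers, integral closure and localization of ideals *)

Section IdealPowers.
Variable R : comNzRingType.
Implicit Types (I J A : set R).

Lemma ideal_gen_ideal A : is_ideal (ideal_gen A).
Proof.
split.
- by exists 0%N, (fun=> 0), (fun=> 0); split=> [[]//|]; rewrite big_ord0.
- move=> _ _ [k [c [g [cg ->]]]] [l [d [h [dh ->]]]].
  exists (k + l)%N, (fun i => match split i with inl i => c i | inr j => d j end),
    (fun i => match split i with inl i => g i | inr j => h j end); split.
    by move=> i; case: split.
  rewrite big_split_ord /=; congr (_ + _); apply: eq_bigr => i _.
    by rewrite -[lshift _ _]/(unsplit (inl i)) unsplitK.
  by rewrite -[rshift _ _]/(unsplit (inr i)) unsplitK.
- move=> a _ [k [c [g [cg ->]]]]; exists k, (fun i => a * c i), g; split.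
    by move=> i; split=> //; case: (cg i).
  by rewrite mulr_sumr; apply: eq_bigr => i _; rewrite mulrA.
Qed.

Lemma sub_ideal_gen A : A `<=` ideal_gen A.
Proof.
by move=> x Ax; exists 1%N, (fun=> 1), (fun=> x); rewrite big_ord1 mul1r.
Qed.

Lemma ideal_sum I (T : Type) (s : seq T) (P : pred T) (f : T -> R) :
  is_ideal I -> (forall i, P i -> I (f i)) -> I (\sum_(i <- s | P i) f i).
Proof. by case=> I0 ID _ If; apply: big_ind. Qed.

Lemma ideal_gen_min A J : is_ideal J -> A `<=` J -> ideal_gen A `<=` J.
Proof.
move=> Jid AJ _ [k [c [g [cg ->]]]]; apply: ideal_sum => // i _.
by case: (Jid) => _ _; apply; apply: AJ; case: (cg i).
Qed.

Lemma ideal_exp_ideal I n : is_ideal (ideal_exp I n).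
Proof. by case: n => [|n]; [split|apply: ideal_gen_ideal]. Qed.

Lemma ideal_exp_prod I (T : eqType) (s : seq T) (f : T -> R) :
  {in s, forall i, I (f i)} -> ideal_exp I (size s) (\prod_(i <- s) f i).
Proof.
elim: s => [|i s IHs] If; first by rewrite big_nil.
rewrite big_cons; apply: sub_ideal_gen; exists (f i).
  by apply: If; rewrite mem_head.
exists (\prod_(j <- s) f j) => //; apply: IHs => j js; apply: If.
by rewrite in_cons js orbT.
Qed.

Lemma ideal_exp_filtration I (V : nat -> set R) d n :
    (forall e, is_ideal (V e)) -> V 0%N = setT ->
    (forall e f x y, V e x -> V f y -> V (e + f)%N (x * y)) ->
  I `<=` V d -> ideal_exp I n `<=` V (n * d)%N.
Proof.
move=> Vid V0 VM IV; elim: n => [|n IHn]; first by rewrite mul0n V0.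
apply: ideal_gen_min => // _ [x Ix [y Iy <-]].
by rewrite mulSn; apply: VM; [apply: IV|apply: IHn].
Qed.

Lemma sub_integral_closure J : is_ideal J -> J `<=` integral_closure J.
Proof.
move=> [J0 JD JM] x Jx; exists 1%N, (fun=> - x); split=> // [i|].
  rewrite ord1; apply: sub_ideal_gen; exists (- x); last by exists 1; rewrite ?mulr1.
  by rewrite -mulN1r; apply: JM.
by rewrite big_ord1 subnn expr1 expr0 mulr1 subrr.
Qed.

End IdealPowers.

Section Localization.
Variable R : idomainType.

(** Clearing denominators: the product of the denominators of a finite sum stays
    outside the prime [P]. *)
Lemma local_contractionP (P J : set R) : is_prime_ideal P -> is_ideal J ->
  local_contraction P J = [set f | exists2 b, ~ P b & J (b * f)].
Proof.
move=> [[P0 _ _] P1 Pp] [J0 JD JM]; apply/seteqP; split=> f /=; last first.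
  move=> [b Pb Jbf]; exists 1%N, (fun=> tofrac 1 / tofrac b), (fun=> tofrac (b * f)).
  split.
    by move=> _; split; [exists 1, b|exists (b * f)].
  have b0 : tofrac b != 0 :> {fraction R}.
    by rewrite tofrac_eq0; apply/eqP => b0; apply: Pb; rewrite b0.
  by rewrite big_ord1 tofracM tofrac1 mul1r mulKf.
move=> [k [c [g [cg fE]]]].
pose M := [set z : {fraction R} |
  exists b, ~ P b /\ exists2 y, J y & tofrac b * z = tofrac y].
suff [b [Pb [y Jy E]]] : M (tofrac f).
  exists b => //; suff -> : b * f = y by [].
  by apply/eqP; rewrite -tofrac_eq tofracM E.
rewrite fE; apply: (@big_ind _ M).
- by exists 1; split => //; exists 0; rewrite // mulr0 tofrac0.
- move=> u v [b [Pb [y Jy E]]] [b' [Pb' [y' Jy' E']]]; exists (b * b'); split.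
    by case/Pp.
  exists (b' * y + b * y'); first by apply: JD; apply: JM.
  rewrite tofracD !tofracM -E -E' mulrDr; congr (_ + _).
    by rewrite mulrCA !mulrA.
  by rewrite mulrA.
- move=> i _; case: (cg i) => -[a [b [Pb ->]]] [y Jy <-]; exists b; split=> //.
  exists (a * y); first exact: JM.
  have b0 : tofrac b != 0 :> {fraction R}.
    by rewrite tofrac_eq0; apply/eqP => b0; apply: Pb; rewrite b0.
  by rewrite tofracM mulrCA -mulrA mulKf.
Qed.

End Localization.

(** * The monomial filtration attached to a set of variables *)

Section WeightFiltration.
Variables (K : fieldType) (s : nat).
Implicit Types (C D : {set 'I_s}) (m : 'X_{1..s}) (p q : {mpoly K[s]}) (d : nat).

Definition weight C m : nat := (\sum_(i in C) m i)%N.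

Lemma weightD C m1 m2 : weight C (m1 + m2)%MM = (weight C m1 + weight C m2)%N.
Proof. by rewrite /weight -big_split; apply: eq_bigr => i _; rewrite mnmDE. Qed.

Lemma weightMn C m k : weight C (m *+ k)%MM = (k * weight C m)%N.
Proof.
by rewrite /weight big_distrr; apply: eq_bigr => i _; rewrite mulmnE mulnC.
Qed.

Definition indicator D : 'X_{1..s} := [multinom nat_of_bool (i \in D) | i < s].

Lemma prod_mpolyX D : \prod_(i in D) 'X_i = 'X_[indicator D] :> {mpoly K[s]}.
Proof.
rewrite mpolyXE_id big_mkcond; apply: eq_bigr => i _.
by rewrite mnmE; case: (i \in D).
Qed.

Lemma weight_indicator C D : weight C (indicator D) = #|C :&: D|%SET.
Proof.
rewrite -sum1_card /weight [RHS](eq_bigl (fun i => (i \in C) && (i \in D))).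
  by rewrite big_mkcondr; apply: eq_bigr => i _; rewrite mnmE; case: (i \in D).
by move=> i; rewrite finset.in_setI.
Qed.

Lemma weight_set2 i j m : i != j -> weight [set i; j]%SET m = (m i + m j)%N.
Proof. by move=> ij; rewrite /weight big_setU1 ?big_set1 // finset.in_set1. Qed.

(** The [d]-th power of the prime ideal generated by the variables in [C],
    described by its monomials. *)
Definition weight_filtration C d : set {mpoly K[s]} :=
  [set p | forall m, m \in msupp p -> (d <= weight C m)%N].

Lemma weight_filtration_ideal C d : is_ideal (weight_filtration C d).
Proof.
split=> [m|p q Vp Vq m /msuppD_le|p q Vq m /msuppM_le]; first by rewrite msupp0.
  by rewrite mem_cat => /orP[/Vp|/Vq].
move=> /allpairsP[[m1 m2] /= [_ /Vq dm2 ->]].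
by rewrite weightD (leq_trans dm2) ?leq_addl.
Qed.

Lemma weight_filtration0 C : weight_filtration C 0 = setT.
Proof. by apply/seteqP; split=> // p _ m. Qed.

Lemma weight_filtrationM C d e p q : weight_filtration C d p ->
  weight_filtration C e q -> weight_filtration C (d + e) (p * q).
Proof.
move=> Vp Vq m /msuppM_le /allpairsP[[m1 m2] /= [/Vp dm1 /Vq em2 ->]].
by rewrite weightD leq_add.
Qed.

Lemma weight_filtration_le C d e : (d <= e)%N ->
  weight_filtration C e `<=` weight_filtration C d.
Proof. by move=> de p Vp m /Vp; apply: leq_trans. Qed.

Lemma mpolyX_weight_filtration C d m :
  weight_filtration C d 'X_[m] <-> (d <= weight C m)%N.
Proof.
split=> [|dm m']; first by apply; rewrite msuppX mem_seq1.
by rewrite msuppX mem_seq1 => /eqP->.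
Qed.

(** The substitution that multiplies the variables in [C] by a new variable; the
    new exponent records the weight.  Being a ring morphism to an integral
    domain, it shows that the ideal of weight at least 1 is prime and that its
    powers are primary, without a choice of leading terms. *)
Definition weight_grading C : {mpoly K[s]} -> {poly {mpoly K[s]}} :=
  mmap (polyC \o @mpolyC s K) (fun i => 'X^(i \in C) * ('X_i)%:P).

Lemma weight_gradingM C : {morph weight_grading C : p q / p * q}.
Proof. exact: rmorphM. Qed.

Lemma weight_gradingD C : {morph weight_grading C : p q / p + q}.
Proof. exact: rmorphD. Qed.

Lemma weight_grading0 C : weight_grading C 0 = 0.
Proof. exact: rmorph0. Qed.

Lemma weight_gradingZ C c p :
  weight_grading C (c *: p) = (c%:MP)%:P * weight_grading C p.
Proof. exact: mmapZ. Qed.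

Lemma weight_grading_mpolyX C m :
  weight_grading C 'X_[m] = 'X^(weight C m) * ('X_[m])%:P.
Proof.
rewrite /weight_grading mmapX /mmap1.
under eq_bigr do rewrite exprMn.
rewrite big_split /=; congr (_ * _).
  rewrite /weight expr_sum [RHS]big_mkcond; apply: eq_bigr => i _.
  by case: (i \in C); rewrite ?expr0 ?expr1n.
rewrite mpolyXE_id rmorph_prod; apply: eq_bigr => i _.
by rewrite rmorphXn.
Qed.

Lemma mcoeff_weight_grading C p k m :
  (weight_grading C p)`_k@_m = if weight C m == k then p@_m else 0.
Proof.
elim/mpolyind: p => [|c m' p _ _ IHp].
  by rewrite weight_grading0 coef0 !mcoeff0; case: ifP.
rewrite weight_gradingD coefD mcoeffD [in RHS]mcoeffD [X in _ + X = _]IHp.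
have -> : (weight_grading C (c *: 'X_[m']))`_k@_m =
    if weight C m' == k then (c *: 'X_[m'])@_m else 0.
  rewrite weight_gradingZ weight_grading_mpolyX coefCM coefXnM coefC subn_eq0.
  by rewrite mul_mpolyC; case: (ltngtP k (weight C m')) => _; rewrite ?scaler0 ?mcoeff0.
have [->|m'm] := eqVneq m' m; first by case: ifP; rewrite ?addr0.
by rewrite mcoeffZ mcoeffX (negPf m'm) mulr0 if_same !add0r.
Qed.

Lemma weight_filtrationP C d p :
  weight_filtration C d p <-> forall k, (k < d)%N -> (weight_grading C p)`_k = 0.
Proof.
split=> [Vp k kd|p0 m].
  apply/mpolyP => m; rewrite mcoeff_weight_grading mcoeff0.
  have [wm|//] := eqP; apply: memN_msupp_eq0; apply: contraTN kd.
  by move=> /Vp; rewrite wm -leqNgt.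
rewrite mcoeff_msupp leqNgt; apply: contra => /p0/(congr1 (mcoeff m)).
by rewrite mcoeff_weight_grading eqxx mcoeff0 => ->.
Qed.

Lemma weight_filtration1 C p : weight_filtration C 1 p <-> (weight_grading C p)`_0 = 0.
Proof.
by rewrite weight_filtrationP; split=> [->//|p0 [|//]].
Qed.

(** The ideal is the kernel of the constant coefficient of the grading, a ring
    morphism to an integral domain. *)
Lemma weight_filtration_prime C : is_prime_ideal (weight_filtration C 1).
Proof.
split; first exact: weight_filtration_ideal.
  move=> /(_ 0%MM); rewrite msupp1 mem_seq1 eqxx => /(_ isT).
  by rewrite /weight big1 // => i _; rewrite mnm0E.
move=> p q /weight_filtration1; rewrite weight_gradingM coef0M => /eqP.
by rewrite mulf_eq0 => /orP[] /eqP ?; [left|right]; apply/weight_filtration1.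
Qed.

(** The powers of the prime [(x_i, i in C)] are primary: if [p] has a nonzero
    part of weight 0, then the lowest part of [q] survives in [p * q], with the
    same weight. *)
Lemma weight_filtration_cancel C d p q : ~ weight_filtration C 1 p ->
  weight_filtration C d (p * q) -> weight_filtration C d q.
Proof.
move=> p0 /weight_filtrationP pq0; apply/weight_filtrationP.
elim/ltn_ind => k IHk kd; have /eqP := pq0 k kd.
rewrite weight_gradingM coefM big_ord_recl subn0 big1 ?addr0 => [|i _]; last first.
  rewrite [X in _ * X]IHk; [exact: mulr0|by have := ltn_ord i; rewrite /= /bump; lia|].
  by apply: leq_ltn_trans kd; rewrite leq_subr.
by rewrite mulf_eq0 => /orP[/eqP/weight_filtration1 //|/eqP].
Qed.

Lemma ideal_mpolyX (J : set {mpoly K[s]}) p : is_ideal J ->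
  (forall m, m \in msupp p -> J 'X_[m]) -> J p.
Proof.
move=> Jid Jm; rewrite (mpolyE p) big_seq; apply: ideal_sum => // m mp.
by rewrite -mul_mpolyC; case: Jid => _ _; apply; apply: Jm.
Qed.

Lemma weight_filtration1_sub C (P : set {mpoly K[s]}) : is_ideal P ->
  (forall i, i \in C -> P 'X_i) -> weight_filtration C 1 `<=` P.
Proof.
move=> Pid PC p Vp; apply: ideal_mpolyX => // m /Vp; rewrite lt0n sum_nat_eq0.
rewrite negb_forall => /existsP[i]; rewrite negb_imply => /andP[iC mi].
have im : (U_(i) <= m)%MM.
  by apply/mnm_lepP => j; rewrite mnm1E; case: eqP => // <-; rewrite lt0n.
by rewrite -(submK im) mpolyXD; case: Pid => _ _; apply; apply: PC.
Qed.

Lemma ideal_exp_weight_filtration C d (I : set {mpoly K[s]}) n :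
  I `<=` weight_filtration C d -> ideal_exp I n `<=` weight_filtration C (n * d).
Proof.
exact: ideal_exp_filtration (weight_filtration_ideal C) (weight_filtration0 C)
  (@weight_filtrationM C).
Qed.

(** The weight is a valuation, so it does not tell an ideal from its integral
    closure: if the weight of [x^m] were less than [d], then in an equation of
    integral dependence of degree [k] the terms other than [(x^m)^k] would all
    have weight greater than [k] times the weight of [x^m]. *)
Lemma integral_closure_weight C d (J : set {mpoly K[s]}) m :
  J `<=` weight_filtration C d -> integral_closure J 'X_[m] -> (d <= weight C m)%N.
Proof.
move=> JV [k [a [k0 Ja /eqP]]]; rewrite addr_eq0 => /eqP Xk.
rewrite leqNgt; apply/negP => wd.
have : weight_filtration C (k * weight C m).+1 ('X_[m] ^+ k).
  rewrite Xk -sumrN; apply: ideal_sum; first exact: weight_filtration_ideal.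
  move=> i _; rewrite -mulNr.
  apply: (@weight_filtration_le _ _ (i.+1 * d + (k - i.+1) * weight C m)%N).
    rewrite -[k in (k * _)%N](subnKC (ltn_ord i)) mulnDl -addSn leq_add2r.
    by rewrite ltn_pmul2l.
  apply: weight_filtrationM; last first.
    by rewrite mpolyXn; apply/mpolyX_weight_filtration; rewrite weightMn.
  have [_ _ VM] := weight_filtration_ideal C (i.+1 * d).
  rewrite -mulN1r; apply: VM.
  exact: ideal_exp_weight_filtration JV _ (Ja i).
by rewrite mpolyXn => /mpolyX_weight_filtration; rewrite weightMn ltnn.
Qed.

End WeightFiltration.

Arguments weight_filtration K {s} C d.

(** * Symbolic and ordinary powers of the ideal of covers *)

Section CoverIdeal.
Variables (K : fieldType) (s : nat) (G : sgraph 'I_s).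
Implicit Types (C D : {set 'I_s}) (m : 'X_{1..s}) (i j : 'I_s).
Local Notation Ic := (cover_ideal K G).
Local Notation "''V_' [ i , j ]" := (weight_filtration K [set i; j]%SET)
  (format "''V_' [ i ,  j ]").

Lemma vertex_coverP D :
  reflect (forall i j, G i j -> i \in D \/ j \in D) (vertex_cover G D).
Proof.
apply: (iffP forallP) => [H i j|H i].
  by move/forallP/(_ j)/implyP: (H i) => ij /ij/orP.
by apply/forallP => j; apply/implyP => /H/orP.
Qed.

Lemma cover_ideal_ideal : is_ideal Ic.
Proof. exact: ideal_gen_ideal. Qed.

Lemma cover_ideal_cover D : vertex_cover G D -> Ic (\prod_(i in D) 'X_i).
Proof.
move=> /minset_exists[D' minD' D'D]; rewrite (big_setID D') /=.
rewrite mulrC (finset.setIidPr D'D); have [_ _] := cover_ideal_ideal; apply.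
by apply: sub_ideal_gen; exists D'.
Qed.

(** The complement of a cover is stable, so it meets a clique at most once. *)
Lemma clique_cover_card C D : clique G C -> vertex_cover G D ->
  (#|C|.-1 <= #|C :&: D|%SET)%N.
Proof.
move=> cC /vertex_coverP covD; rewrite -(cardsID D C).
have : (#|C :\: D|%SET <= 1)%N.
  rewrite finset.setDE; apply: card_cliqueI_stable cC _; apply/stableP => i j.
  by rewrite !finset.in_setC => iD jD; apply/negP => /covD[]; apply/negP.
lia.
Qed.

Lemma cover_ideal_clique C : clique G C -> Ic `<=` weight_filtration K C #|C|.-1.
Proof.
move=> cC; apply: ideal_gen_min; first exact: weight_filtration_ideal.
move=> _ [D [/minsetp covD ->]]; rewrite prod_mpolyX.
by apply/mpolyX_weight_filtration; rewrite weight_indicator clique_cover_card.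
Qed.

Lemma edge_neq i j : G i j -> i != j.
Proof. by apply: contraTneq => ->; rewrite edge_irr. Qed.

Lemma cover_ideal_edge i j : G i j -> Ic `<=` 'V_[i, j] 1.
Proof.
move=> ij; have := @cover_ideal_clique [set i; j]%SET.
rewrite cards2 edge_neq //; apply; apply/cliqueP => x y.
by rewrite !finset.in_set2 => /orP[]/eqP-> /orP[]/eqP->; rewrite ?eqxx // edge_sym.
Qed.

(** The vertices whose variable is not in [P] do not form a cover, as the product
    of their variables is not in [P]; an edge that they miss does the job. *)
Lemma prime_cover_edge P : is_prime_ideal P -> Ic `<=` P ->
  exists i j, G i j /\ 'V_[i, j] 1 `<=` P.
Proof.
move=> [Pid P1 Pp] IP.
pose D := [set i | ~~ `[< P 'X_i >]]%SET.
have : ~ P (\prod_(i in D) 'X_i).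
  apply: (@big_ind _ (fun p => ~ P p)) => // [p q Pp' Pq' /Pp[]//|i].
  by rewrite finset.in_set => /asboolP.
have [/cover_ideal_cover/IP //|] := boolP (vertex_cover G D).
rewrite negb_forall => /existsP[i]; rewrite negb_forall => /existsP[j].
rewrite negb_imply negb_or !finset.in_set !negbK.
move=> /and3P[ij /asboolP Pi /asboolP Pj] _.
exists i, j; split=> //; apply: weight_filtration1_sub => // k.
by rewrite finset.in_set2 => /orP[]/eqP->.
Qed.

Lemma mpolyX_edge_prime i j k : 'V_[i, j] 1 'X_k <-> k \in [set i; j]%SET.
Proof.
rewrite mpolyX_weight_filtration lt0n sum_nat_eq0 negb_forall; split.
  move=> /existsP[l]; rewrite negb_imply mnm1E => /andP[].
  by have [->|] := eqVneq k l.
by move=> kij; apply/existsP; exists k; rewrite kij mnm1E eqxx.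
Qed.

(** Since every prime over the ideal contains an edge prime, what remains to
    see is that one edge prime never contains another. *)
Lemma minimal_prime_coverP P :
  minimal_prime Ic P <-> exists i j, G i j /\ P = 'V_[i, j] 1.
Proof.
split=> [[Pp IP minP]|[i [j [ij ->]]]].
  have [i [j [ij VP]]] := prime_cover_edge Pp IP; exists i, j; split=> //.
  by rewrite (minP _ _ _ VP) //; [exact: weight_filtration_prime|exact: cover_ideal_edge].
split; [exact: weight_filtration_prime|exact: cover_ideal_edge|].
move=> Q Qp IQ QV; apply/seteqP; split=> //.
have [k [l [kl VQ]]] := prime_cover_edge Qp IQ.
suff <- : [set k; l]%SET = [set i; j]%SET by [].
apply/eqP; rewrite eqEcard !cards2 !edge_neq // andbT.
by apply/fintype.subsetP => x /mpolyX_edge_prime/VQ/QV/mpolyX_edge_prime.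
Qed.

(** The symbolic power is the intersection of the [n]-th powers of the edge
    primes.  The inclusion from left to right holds as these powers are primary.
    Conversely, at the edge [ij] the covers that omit only [j], or only [i], are
    [x_i] or [x_j] up to a unit of the local ring, so a monomial with
    [m i + m j >= n] is a unit times a product of [n] of them and of other
    monomials. *)
Lemma symbolic_power_coverP n (f : {mpoly K[s]}) :
  symbolic_power Ic n f <-> forall i j, G i j -> 'V_[i, j] n f.
Proof.
have expid : is_ideal (ideal_exp Ic n) by exact: ideal_exp_ideal.
split=> [Sf i j ij|Vf P /minimal_prime_coverP[i [j [ij ->]]]].
  have /Sf : minimal_prime Ic ('V_[i, j] 1).
    by apply/minimal_prime_coverP; exists i, j.
  rewrite (local_contractionP (weight_filtration_prime _ _) expid) => -[b b1 bf].
  apply: weight_filtration_cancel b1 _.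
  have := ideal_exp_weight_filtration (cover_ideal_edge ij) bf.
  by rewrite muln1.
have Vp := weight_filtration_prime K [set i; j]%SET.
rewrite (local_contractionP Vp expid).
apply: ideal_mpolyX => [|m /(Vf i j ij)].
  have [[_ _ _] V1 VM] := Vp; have [J0 JD JM] := expid.
  split=> [|x y [b Vb Jb] [c Vc Jc]|a x [b Vb Jb]].
  - by exists 1; rewrite ?mulr0.
  - exists (b * c); first by case/VM.
    by rewrite mulrDr; apply: JD; [rewrite mulrAC mulrC|rewrite -mulrA]; apply: JM.
  - by exists b => //; rewrite mulrCA; apply: JM.
rewrite weight_set2 ?edge_neq // => nm.
(* The n covers consist of a complements of j and b complements of i.  They use
   exactly n copies of each variable outside the edge, which the multiplier,
   a monomial prime to x_i and x_j, provides. *)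
pose a := minn (m i) n; pose b := (n - a)%N.
exists 'X_[[multinom (if (k == i) || (k == j) then 0 else n)%N | k < s]].
  rewrite mpolyX_weight_filtration weight_set2 ?edge_neq //.
  by rewrite !mnmE !eqxx orbT.
have Icov k : vertex_cover G [set~ k]%SET.
  apply/vertex_coverP => x y xy; rewrite !finset.in_setC1.
  by have [xk|] := eqVneq x k; [right; rewrite -xk eq_sym edge_neq|left].
have := @ideal_exp_prod _ Ic bool (nseq a true ++ nseq b false)
  (fun c : bool => \prod_(k in if c then [set~ j]%SET else [set~ i]%SET) 'X_k).
rewrite size_cat !size_nseq subnKC ?geq_minr // big_cat /= !big_nseq !iter_mulr_1.
rewrite !prod_mpolyX !mpolyXn -!mpolyXD => Jg.
rewrite [X in 'X_[X]](_ : _ = [multinom m k - (a * (k == i) + b * (k == j)) | k < s] +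
    (indicator [set~ j]%SET *+ a + indicator [set~ i]%SET *+ b))%MM; last first.
  apply/mnmP => k; rewrite !(mnmDE, mulmnE, mnmE) !finset.in_setC1.
  have [->|ki] := eqVneq k i.
    by rewrite edge_neq //= /b /a; lia.
  have [->|kj] := eqVneq k j; rewrite /= /b /a; lia.
rewrite mpolyXD; case: expid => _ _; apply; apply: Jg => -[] _;
  exact: cover_ideal_cover.
Qed.

(** The complements of [r] stable sets are [r] covers.  If [i] is in at least
    [r - m i] of the stable sets, then it is in at most [m i] of the covers, so
    the product of the covers divides [x^m]. *)
Lemma cover_ideal_exp_mpolyX r m :
  weighted_colorable G (fun i => r - m i)%N r -> ideal_exp Ic r 'X_[m].
Proof.
move=> [t [<- st rm]]; have [_ _ JM] := ideal_exp_ideal Ic (size t).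
pose u := (\sum_(S <- t) indicator (~: S))%MM.
have um : (u <= m)%MM.
  apply/mnm_lepP => i; rewrite mnm_sumE.
  have : (\sum_(S <- t) indicator (~: S)%SET i +
          count (fun S : {set 'I_s} => i \in S) t = size t)%N.
    rewrite -sum1_count [X in (_ + X)%N]big_mkcond -big_split.
    rewrite -sum1_size; apply: eq_bigr => S _.
    by rewrite mnmE finset.in_setC; case: (i \in S).
  by move=> E; have := rm i; rewrite leq_subLR -E leq_add2r.
rewrite -(submK um) mpolyXD; apply: JM.
rewrite -mprodXE; apply: ideal_exp_prod => S /(allP st)/stableP sS.
rewrite -prod_mpolyX; apply: cover_ideal_cover; apply/vertex_coverP => i j ij.
rewrite !finset.in_setC; have [iS|] := boolP (i \in S); last by left.
by right; apply: contraTN ij; apply: sS.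
Qed.

(** Summing [n <= m i + m j] over the ordered pairs of distinct vertices of [C]
    counts each [m i] exactly [2 * (#|C| - 1)] times. *)
Lemma sum_edges_clique C m n : clique G C -> (1 < #|C|)%N ->
    (forall i j, G i j -> (n <= m i + m j)%N) ->
  (#|C| * n <= 2 * weight C m)%N.
Proof.
move=> /cliqueP cC c1 mn.
have H i : i \in C -> (2 * m i + #|C|.-1 * n <= #|C| * m i + weight C m)%N.
  move=> iC.
  have -> : (#|C| * m i + weight C m = \sum_(j in C) (m i + m j))%N.
    by rewrite big_split /= sum_nat_const.
  rewrite (bigD1 i) //= mul2n addnn leq_add2l (cardsD1 i) iC /=.
  rewrite -sum_nat_const [leqRHS](eq_bigl (fun j => j \in C :\ i)).
    by apply: leq_sum => j /setD1P[ji jC]; apply/mn/cC; rewrite // eq_sym.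
  by move=> j; rewrite finset.in_setD1 andbC.
have : (\sum_(i in C) (2 * m i + #|C|.-1 * n) <=
        \sum_(i in C) (#|C| * m i + weight C m))%N by exact: leq_sum.
rewrite !big_split /= !sum_nat_const -!big_distrr /= -/(weight C m).
rewrite -[in X in _ -> X](@leq_pmul2l #|C|.-1) -?subn1 ?subn_gt0 //.
move: c1; case: #|C| => // k _; rewrite subn1 /=; nia.
Qed.

(** By replication, it suffices that every clique has weight at most [r] for
    [r - a i].  Only its vertices with [a i < r] count; if they form a clique [C]
    with [c] elements, its weight is [c r - a(C)], so the condition is
    [(c - 1) r <= a(C)].  It follows from [c n <= 2 a(C)], as [2 (c - 1) / c]
    increases with [c].  For [c <= 1] there is no edge to use and the weight is
    at most [r] anyway. *)
Lemma symbolic_power_cover_sub n r : perfect G ->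
    (2 * r * (clique_number G).-1 <= n * clique_number G)%N ->
  symbolic_power Ic n `<=` ideal_exp Ic r.
Proof.
move=> perfG; set w := clique_number G => nr f /symbolic_power_coverP Vf.
apply: ideal_mpolyX; first exact: ideal_exp_ideal.
move=> a fa; apply: cover_ideal_exp_mpolyX; apply: perfect_weighted_colorable => //.
move=> C0 cC0; pose C := C0 :&: [set i | a i < r]%N%SET.
have cC : clique G C by apply: sub_clique cC0; apply: finset.subsetIl.
have Cw : (#|C| <= w)%N by apply: leq_bigmax_cond cC.
have -> : (\sum_(i in C0) (r - a i) = \sum_(i in C) (r - a i))%N.
  rewrite [RHS](eq_bigl (fun i => (i \in C0) && (a i < r)%N)).
    rewrite [RHS]big_mkcondr; apply: eq_bigr => i _.
    by case: ltnP => //; rewrite -subn_eq0 => /eqP.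
  by move=> i; rewrite finset.in_setI finset.in_set.
have sumE : (\sum_(i in C) (r - a i) + weight C a = #|C| * r)%N.
  rewrite /weight -big_split /= -sum_nat_const; apply: eq_bigr => i.
  by rewrite finset.in_setI finset.in_set => /andP[_ /ltnW]; apply: subnK.
have c2w : (1 < #|C|)%N -> (#|C| * n <= 2 * weight C a)%N.
  move=> c1; apply: (sum_edges_clique cC c1) => i j ij.
  by have := Vf i j ij a fa; rewrite weight_set2 // edge_neq.
have [c1|c1] := ltnP 1 #|C|; last first.
  by move: sumE c1; case: #|C| => [|[|//]]; lia.
have am := c2w c1.
suff : (#|C|.-1 * r <= weight C a)%N.
  by move: sumE; case: #|C| => [|c /=]; rewrite ?mulSn; lia.
have w0 : (0 < 2 * w)%N by rewrite muln_gt0 /= (leq_trans (ltnW c1)).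
rewrite -(leq_pmul2l w0).
have cw : (w * #|C|.-1 <= #|C| * w.-1)%N by nia.
have /leq_trans-> // : (2 * w * (#|C|.-1 * r) <= #|C| * (2 * r * w.-1))%N by nia.
have : (#|C| * (2 * r * w.-1) <= #|C| * (n * w))%N by rewrite leq_mul2l nr orbT.
by move=> /leq_trans->//; nia.
Qed.

Lemma clique_number_clique : exists2 C, clique G C & #|C| = clique_number G.
Proof.
have [|C cC E] := @eq_bigmax_cond _ (clique G) (fun C : {set 'I_s} => #|C|).
  apply/card_gt0P; exists finset.set0; apply/cliqueP => x y.
  by rewrite finset.in_set0.
by exists C.
Qed.

(** The witness is the monomial with all exponents [(w - 1) t]: its weight on a
    maximum clique is [w (w - 1) t], which is less than [(w - 1) (w t + 1)]. *)
Lemma symbolic_power_cover_nsub t : (1 < clique_number G)%N ->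
  ~ symbolic_power Ic (2 * ((clique_number G).-1 * t)) `<=`
    integral_closure (ideal_exp Ic (clique_number G * t).+1).
Proof.
move=> w1 sub; have [C cC Cw] := clique_number_clique.
pose m : 'X_{1..s} := [multinom ((clique_number G).-1 * t)%N | i < s].
have /sub : symbolic_power Ic (2 * ((clique_number G).-1 * t)) 'X_[m].
  apply/symbolic_power_coverP => i j ij; apply/mpolyX_weight_filtration.
  by rewrite weight_set2 ?edge_neq // !mnmE mul2n addnn.
move=> /(integral_closure_weight (ideal_exp_weight_filtration (cover_ideal_clique cC))).
rewrite /weight (eq_bigr (fun=> ((clique_number G).-1 * t)%N)) => [|i _];
  last exact: mnmE.
rewrite sum_nat_const Cw; case: clique_number w1 => [|[|w]] // _ /=; nia.
Qed.

Lemma clique_number_gt0 : (0 < s)%N -> (0 < clique_number G)%N.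
Proof.
move=> s0; apply: leq_trans (leq_bigmax_cond _ (clique_set1 G (Ordinal s0))).
by rewrite cards1.
Qed.

End CoverIdeal.

(** * The resurgences *)

Section CoverResurgence.
Variables (F : realType) (K : fieldType) (s : nat) (s_gt0 : (0 < s)%N).
Variable G : sgraph 'I_s.
Local Notation Ic := (cover_ideal K G).
Local Notation w := (clique_number G).
Local Notation bound := (2 * (w%:R - 1) / w%:R : F).

Lemma ic_resurgence_le (R : idomainType) (I : set R) :
  (ic_resurgence F I <= resurgence F I)%E.
Proof.
apply: ereal_sup_le => q [->|[m [r [m0 r0 sub ->]]]]; first by left.
right; exists m, r; split=> // Isub; apply: sub => x /Isub.
exact/sub_integral_closure/ideal_exp_ideal.
Qed.

Lemma ic_resurgence_cover_ge : (bound%:E <= ic_resurgence F Ic)%E.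
Proof.
have w0 := clique_number_gt0 G s_gt0.
have [w1|w1] := ltnP 1 w; last first.
  have -> : w = 1%N by apply/eqP; rewrite eqn_leq w1.
  by rewrite subrr mulr0 mul0r; apply: ereal_sup_ubound; left.
apply/lee_addgt0Pr => e e0.
(* large enough for 2(w-1)t / (wt+1) to be within e of the bound *)
pose t := (Num.truncn (bound / e)).+1.
have te : bound < t%:R * e.
  by rewrite -ltr_pdivrMr // truncnS_gt.
have ub : (((2 * (w.-1 * t))%:R / (w * t).+1%:R : F)%:E <= ic_resurgence F Ic)%E.
  apply: ereal_sup_ubound; right; exists (2 * (w.-1 * t))%N, (w * t).+1.
  split=> //; last exact: symbolic_power_cover_nsub.
  by rewrite !muln_gt0 /= -subn1 subn_gt0 w1.
apply: le_trans (leeD2r e%:E ub); rewrite -EFinD lee_fin.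
have wF : 0 < w%:R :> F by rewrite ltr0n.
have tF : 0 < t%:R :> F by rewrite ltr0n.
have -> : (w * t).+1%:R = w%:R * t%:R + 1 :> F by rewrite -natrM natr1.
rewrite !natrM -subn1 natrB //.
move: te; set W : F := w%:R in wF *; set u : F := t%:R in tF * => te.
have W1 : 1 <= W by rewrite ler1n.
have Wu : 0 < W * u + 1 by nra.
rewrite -subr_ge0.
have -> : 2 * ((W - 1) * u) / (W * u + 1) + e - 2 * (W - 1) / W =
  (e * (W * u + 1) - 2 * (W - 1) / W) / (W * u + 1).
  by field; rewrite !gt_eqF.
apply: divr_ge0; last exact: ltW.
rewrite subr_ge0 (le_trans (ltW te)) // mulrC ler_pM2l // -subr_ge0.
have -> : W * u + 1 - u = (W - 1) * u + 1 by ring.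
by rewrite addr_ge0 // mulr_ge0 ?subr_ge0 // ltW.
Qed.

Lemma resurgence_cover_le : perfect G -> (resurgence F Ic <= bound%:E)%E.
Proof.
move=> perfG; have w0 := clique_number_gt0 G s_gt0.
have wF : 0 < w%:R :> F by rewrite ltr0n.
apply: ub_ereal_sup => _ [->|[m [r [m0 r0 sub ->]]]]; rewrite lee_fin.
  by rewrite divr_ge0 ?ler0n // mulr_ge0 ?subr_ge0 ?ler1n.
have : (m * w <= 2 * r * w.-1)%N.
  rewrite leqNgt; apply/negP => /ltnW mw.
  exact/sub/symbolic_power_cover_sub.
rewrite -(ler_nat F) !natrM -subn1 natrB // => mw.
by rewrite ler_pdivrMr ?ltr0n // mulrAC ler_pdivlMr // mulrAC.
Qed.

End CoverResurgence.

Theorem theorem6p2 (F : realType) (K : fieldType) (s : nat) (s_gt0 : (0 < s)%N)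
    (G : sgraph 'I_s) :
  [/\ (resurgence F (cover_ideal K G) >= ic_resurgence F (cover_ideal K G))%E,
      (ic_resurgence F (cover_ideal K G) >=
        (2 * ((clique_number G)%:R - 1) / (clique_number G)%:R)%R%:E)%E &
      perfect G ->
        resurgence F (cover_ideal K G) = ic_resurgence F (cover_ideal K G) /\
        ic_resurgence F (cover_ideal K G) =
          (2 * ((clique_number G)%:R - 1) / (clique_number G)%:R)%R%:E].
Proof.
have le_ic := ic_resurgence_le F (cover_ideal K G).
have ge_bound := ic_resurgence_cover_ge F K s_gt0 G.
split=> // perfG; have le_bound := resurgence_cover_le F K s_gt0 perfG.
split; apply/eqP; rewrite eq_le.
  by rewrite le_ic (le_trans le_bound).
by rewrite ge_bound (le_trans le_ic).
Qed.
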